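(* Let $\Omega\subset\mathbb{R}^n$ be a bounded Lipschitz domain, $N\in\mathbb{N}$, $\mu>0$, $u^c\in L^2(\Omega;\mathbb{R}^N)$, and suppose that $u^\eta\in\mathbb{H}^\varepsilon(\Omega;\mathbb{R}^N)$ for some $\varepsilon\in(0,1)$. Suppose that $$\sum_{j=1}^N\sum_{m=1}^\infty\log(\lambda_m)\,\widehat{(u^\eta_j)}_m\Bigl(\widehat{(u^\eta_j)}_m-(1+\mu)\widehat{(u^c_j)}_m\Bigr)>0$$ and $$\sum_{j=1}^N\sum_{m=1}^\infty\frac{\log(\lambda_m)\lambda_m}{(1+\mu\lambda_m)^3}\,\widehat{(u^\eta_j)}_m\Bigl(\widehat{(u^\eta_j)}_m-(1+\mu\lambda_m)\widehat{(u^c_j)}_m\Bigr)<0.$$ Then the functional $$\mathcal{I}:(0,1)\to[0,\infty),\qquad\mathcal{I}(s)=\|w^{(s)}-u^c\|^2_{L^2(\Omega;\mathbb{R}^N)},$$ where, for $j\in\{1,\dots,N\}$, $w^{(s)}_j$ is the unique minimizer over $u\in L^2(\Omega)$ of $\mathcal{J}_{s,j}(u)=\|u-u^\eta_j\|^2_{L^2(\Omega)}+\mathcal{R}_s(u)$, admits a minimizer $\bar s\in(0,1)$.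
   Context: Let $(\psi_m)_{m\in\mathbb{N}}\subset H^1_0(\Omega)$ be a sequence of eigenfunctions of the Dirichlet Laplacian forming an orthonormal basis of $L^2(\Omega)$, with eigenvalues $0<\lambda_1\le\lambda_2\le\dots\nearrow\infty$: $(-\Delta)\psi_m=\lambda_m\psi_m$ in $\Omega$, $\psi_m=0$ on $\partial\Omega$. For $u\in L^2(\Omega)$ write $\hat u_m=\langle u,\psi_m\rangle_{L^2(\Omega)}$. For $s\in(0,1)$, $$\mathbb{H}^s(\Omega)=\Bigl\{u=\sum_{m=1}^\infty\hat u_m\psi_m\in L^2(\Omega):\sum_{m=1}^\infty\lambda_m^s\hat u_m^2<\infty\Bigr\},\qquad(-\Delta_D)^{s/2}u=\sum_{m=1}^\infty\lambda_m^{s/2}\hat u_m\psi_m\ \text{ for }u\in\mathbb{H}^s(\Omega),$$ and $\mathbb{H}^s(\Omega;\mathbb{R}^N)$ is the set of $u\in L^2(\Omega;\mathbb{R}^N)$ with all components in $\mathbb{H}^s(\Omega)$. The regularizer is $\mathcal{R}_s(u)=\mu\|(-\Delta_D)^{s/2}u\|^2_{L^2(\Omega)}$ for $u\in\mathbb{H}^s(\Omega)$ and $\mathcal{R}_s(u)=\infty$ for $u\in L^2(\Omega)\setminus\mathbb{H}^s(\Omega)$. Norm convention: $\|v\|^2_{L^2(\Omega;\mathbb{R}^N)}=\sum_{j=1}^N\|v_j\|^2_{L^2(\Omega)}$. *)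

(* Defs.v *)
From HB Require Import structures.
From mathcomp Require Import all_boot all_order all_algebra.
From mathcomp Require Import all_classical all_reals all_analysis.

Set Implicit Arguments.
Unset Strict Implicit.
Unset Printing Implicit Defensive.

Import Order.TTheory GRing.Theory Num.Theory.
Import numFieldNormedType.Exports.

Local Open Scope classical_set_scope.
Local Open Scope ring_scope.

(* R^n is 'rV[R]_n: the library provides its topology (through the sup norm,
   equivalent to the Euclidean one) but no sigma-algebra.  As for tuples, we
   take the one generated by the coordinates, i.e., the Borel sigma-algebra. *)

Definition rV_display : measure_display. Proof. exact: default_measure_display. Qed.

Section measurable_rV.
Context (R : realType) (n : nat).

Definition rV_coord (i : 'I_n) (x : 'rV[R]_n) : measurableTypeR R := x ord0 i.

Let rV_set0 : g_sigma_preimage rV_coord set0.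
Proof. exact: sigma_algebra0. Qed.

Let rV_setC A : g_sigma_preimage rV_coord A -> g_sigma_preimage rV_coord (~` A).
Proof. exact: sigma_algebraC. Qed.

Let rV_bigcup (F : (set 'rV[R]_n)^nat) :
  (forall i, g_sigma_preimage rV_coord (F i)) ->
  g_sigma_preimage rV_coord (\bigcup_i (F i)).
Proof. exact: sigma_algebra_bigcup. Qed.

HB.instance Definition _ := @isMeasurable.Build rV_display
  'rV[R]_n (g_sigma_preimage rV_coord) rV_set0 rV_setC rV_bigcup.

Lemma measurable_rV_coord (i : 'I_n) : measurable_fun setT (rV_coord i).
Proof.
move=> _ Y mY; rewrite setTI; apply: sub_sigma_algebra => /=.
rewrite -bigcup_seq/=; exists i => /=; first by rewrite mem_index_enum.
by exists Y => //; rewrite setTI.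
Qed.

Lemma measurable_fun_rVP d (T : measurableType d) (f : T -> 'rV[R]_n) :
  (forall i, measurable_fun setT (rV_coord i \o f)) -> measurable_fun setT f.
Proof.
move=> mf.
suff prefS : g_sigma_preimage (fun i => rV_coord i \o f) `<=` measurable.
  move=> _ A mA; apply: prefS; rewrite g_sigma_preimage_comp.
  by exists A.
apply: smallest_sub; first exact: sigma_algebra_measurable.
move=> A; rewrite -bigcup_seq/= => -[i _ [B mB <-]].
exact: mf.
Qed.

End measurable_rV.

(* The n-dimensional Lebesgue measure, by induction on n: the point mass on
   R^0, then the product measure transported along R * R^n = R^(1 + n). *)

Section lebesgue_rV_step.
Context (R : realType) (n : nat) (mu : {sigma_finite_measure set 'rV[R]_n -> \bar R}).

Definition rV_cons (p : measurableTypeR R * 'rV[R]_n) : 'rV[R]_n.+1 :=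
  \row_i oapp (p.2 ord0) p.1 (unlift ord0 i).

Definition rV_uncons (x : 'rV[R]_n.+1) : measurableTypeR R * 'rV[R]_n :=
  (x ord0 ord0, \row_j x ord0 (lift ord0 j)).

Lemma rV_consK : cancel rV_cons rV_uncons.
Proof.
move=> [a v]; rewrite /rV_uncons !mxE unlift_none/=; congr pair.
by apply/rowP => j; rewrite !mxE liftK.
Qed.

Lemma measurable_rV_cons : measurable_fun setT rV_cons.
Proof.
apply: measurable_fun_rVP => i; rewrite /comp /rV_coord /rV_cons.
under eq_fun do rewrite mxE.
case: (unlift ord0 i) => [j|] /=; last exact: measurable_fst.
exact: (measurableT_comp (measurable_rV_coord j) measurable_snd).
Qed.

Lemma measurable_rV_uncons : measurable_fun setT rV_uncons.
Proof.
apply: measurable_fun_pair; first exact: measurable_rV_coord.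
apply: measurable_fun_rVP => i; rewrite /comp /rV_coord.
under eq_fun do rewrite mxE.
exact: measurable_rV_coord.
Qed.

Definition lebesgue_rVS : set 'rV[R]_n.+1 -> \bar R :=
  pushforward (lebesgue_measure \x mu)%E rV_cons.

Let pre_measurable A : measurable A -> measurable (rV_cons @^-1` A).
Proof. by move=> mA; rewrite -[X in measurable X]setTI; exact: measurable_rV_cons. Qed.

Let rVS0 : lebesgue_rVS set0 = 0%E.
Proof. by rewrite /lebesgue_rVS /pushforward preimage_set0 measure0. Qed.

Let rVS_ge0 A : (0 <= lebesgue_rVS A)%E.
Proof. exact: (measure_ge0 (lebesgue_measure \x mu)%E). Qed.

Let rVS_sigma_additive : semi_sigma_additive lebesgue_rVS.
Proof.
move=> F mF tF mUF; rewrite /lebesgue_rVS /pushforward preimage_bigcup.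
apply: measure_semi_sigma_additive.
- by move=> k; exact: pre_measurable.
- apply/trivIsetP => /= i j _ _ ij; rewrite -preimage_setI.
  by move/trivIsetP : tF => /(_ _ _ _ _ ij) ->//; rewrite preimage_set0.
- by rewrite -preimage_bigcup; exact: pre_measurable.
Qed.

HB.instance Definition _ := isMeasure.Build _ _ _ lebesgue_rVS
  rVS0 rVS_ge0 rVS_sigma_additive.

Let rVS_sigma_finite : sigma_finite setT lebesgue_rVS.
Proof.
have /sigma_finiteP[F [TF ndF Foo]] := sigma_finiteT (@lebesgue_measure R).
have /sigma_finiteP[G [TG ndG Goo]] := sigma_finiteT mu.
exists (fun k => rV_uncons @^-1` (F k `*` G k)).
  rewrite -preimage_bigcup (_ : \bigcup_k _ = setT) ?preimage_setT//.
  rewrite -subTset => -[x y] _.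
  have [i _ Fix] : (\bigcup_i F i) x by rewrite -TF.
  have [j _ Gjy] : (\bigcup_j G j) y by rewrite -TG.
  exists (maxn i j) => //; split => /=.
    by move: x Fix; exact/subsetPset/ndF/leq_maxl.
  by move: y Gjy; exact/subsetPset/ndG/leq_maxr.
move=> k; have [mF Fk] := Foo k; have [mG Gk] := Goo k; split.
  rewrite -[X in measurable X]setTI; apply: measurable_rV_uncons => //.
  exact: measurableX.
rewrite /lebesgue_rVS /pushforward -comp_preimage (_ : _ \o _ = id); last first.
  by apply/funext => p /=; rewrite rV_consK.
by rewrite preimage_id product_measure1E// lte_mul_pinfty// ge0_fin_numE.
Qed.

HB.instance Definition _ := Measure_isSigmaFinite.Build _ _ _ lebesgue_rVS
  rVS_sigma_finite.

End lebesgue_rV_step.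

Fixpoint lebesgue_rV (R : realType) (n : nat) :
    {sigma_finite_measure set 'rV[R]_n -> \bar R} :=
  match n with
  | 0 => [the {sigma_finite_measure set 'rV[R]_0 -> \bar R} of \d_(0 : 'rV[R]_0)]
  | m.+1 => [the {sigma_finite_measure set 'rV[R]_m.+1 -> \bar R} of
              lebesgue_rVS (lebesgue_rV R m)]
  end.

Lemma lebesgue_rV_box (R : realType) n (A : 'I_n -> set (measurableTypeR R)) :
  (forall i, measurable (A i)) ->
  measurable [set x : 'rV[R]_n | forall i, A i (x ord0 i)] /\
  lebesgue_rV R n [set x : 'rV[R]_n | forall i, A i (x ord0 i)] = (\prod_(i < n) lebesgue_measure (A i))%E.
Proof.
elim: n A => [|n IH] A mA.
  rewrite (_ : [set x | _] = setT); last by apply/seteqP; split => // x _ [].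
  split; first exact: measurableT.
  by rewrite big_ord0 /= diracT.
have [mB IB] := IH (fun i => A (lift ord0 i)) (fun i => mA _).
split.
  rewrite (_ : [set x | _] = \bigcap_(i in setT) ((@rV_coord R n.+1 i) @^-1` A i)); last first.
    by apply/seteqP; split => x /= H i => [_|]; [exact: (H i)|exact: (H i I)].
  apply: fin_bigcap_measurable => // i _.
  by rewrite -[X in measurable X]setTI; exact: measurable_rV_coord.
rewrite big_ord_recl -IB /= /lebesgue_rVS /pushforward -product_measure1E//.
congr (_ _); apply/seteqP; split => -[a v] /=.
  move=> H; split => /=; first by have := H ord0; rewrite /rV_cons mxE unlift_none.
  by move=> i; have := H (lift ord0 i); rewrite /rV_cons mxE liftK.
move=> [Ha Hv] i; rewrite /rV_cons mxE.
by case: unliftP => [j ->|->] //=.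
Qed.

(* Strong Lipschitz boundary: near each boundary point, and in suitable
   orthonormal coordinates, Om is the strict epigraph of a Lipschitz function
   of the last n coordinates (the translation is absorbed in gamma).  Since Om
   is open, its boundary is closure Om `\` Om. *)
Definition bounded_lipschitz_domain (R : realType) (n : nat)
    (Om : set 'rV[R]_n.+1) : Prop :=
  [/\ Om !=set0, open Om, connected Om, bounded_set Om &
      forall x0, (closure Om `\` Om) x0 ->
      exists (Q : 'M[R]_n.+1) (gamma : 'rV[R]_n -> R),
        [/\ Q *m Q^T = 1%:M, lipschitz gamma &
            \forall x \near x0,
              Om x <-> gamma (col' ord0 (x *m Q)) < (x *m Q) ord0 ord0]].

Section function_spaces.
Context (R : realType) (n : nat) (Om : set 'rV[R]_n).
Local Notation mu := (lebesgue_rV R n).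
Implicit Types (f g u v phi : 'rV[R]_n -> R) (i : 'I_n).

(* Elements of L^2(Om) are represented by functions on R^n of which only the
   restriction to Om matters: f \_ Om is f on Om and 0 elsewhere.  Equality in
   L^2(Om) is ae_eq mu Om. *)
Definition L2 : set ('rV[R]_n -> R) := [set f | f \_ Om \in Lfun mu 2%:E].

Definition L2norm f : \bar R := 'N[mu]_2%:E[EFin \o (f \_ Om)]%E.

Definition L2inner f g : R := \int[mu]_(x in Om) (f x * g x).

Definition L2cvg (F : nat -> 'rV[R]_n -> R) f : Prop :=
  L2norm (F k \- f) @[k --> \oo] --> 0%E.

Definition orthonormal_basis (psi : nat -> 'rV[R]_n -> R) : Prop :=
  [/\ forall m, L2 (psi m),
      forall m k, L2inner (psi m) (psi k) = (m == k)%:R &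
      forall u, L2 u ->
        L2cvg (fun k x => \sum_(m < k) L2inner u (psi m) * psi m x) u].

Definition partial i f : 'rV[R]_n -> R := 'D_(delta_mx ord0 i) f.

Fixpoint class_C (k : nat) f : Prop :=
  continuous f /\
  if k is k'.+1 then
    forall i, (forall x, derivable f x (delta_mx ord0 i)) /\
              class_C k' (partial i f)
  else True.

Definition test_function : set ('rV[R]_n -> R) :=
  [set phi | [/\ forall k, class_C k phi,
                 compact (closure [set x | phi x != 0]) &
                 closure [set x | phi x != 0] `<=` Om]].

(* u is in H^1(Om) and g is its weak gradient. *)
Definition H1_gradient u (g : 'I_n -> 'rV[R]_n -> R) : Prop :=
  [/\ L2 u, forall i, L2 (g i) &
      forall phi i, test_function phi ->
        L2inner u (partial i phi) = - L2inner (g i) phi].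

(* H^1_0(Om) is the closure of the test functions in H^1(Om). *)
Definition H10 : set ('rV[R]_n -> R) :=
  [set u | exists2 g, H1_gradient u g &
     exists phi : nat -> 'rV[R]_n -> R,
       [/\ forall k, test_function (phi k), L2cvg phi u &
           forall i, L2cvg (fun k => partial i (phi k)) (g i)]].

(* Weak form of - Laplacian u = lam u in Om, u = 0 on the boundary. *)
Definition dirichlet_eigen (lam : R) u : Prop :=
  H10 u /\
  exists2 g, H1_gradient u g &
    forall phi, test_function phi ->
      \sum_i L2inner (g i) (partial i phi) = lam * L2inner u phi.

(* The indices of lam and psi start from 0 instead of 1. *)
Definition dirichlet_eigenbasis (lam : nat -> R)
    (psi : nat -> 'rV[R]_n -> R) : Prop :=
  [/\ orthonormal_basis psi,
      forall m, dirichlet_eigen (lam m) (psi m),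
      0 < lam 0%N, nondecreasing_seq lam & lam @ \oo --> +oo].

End function_spaces.

Section spectral_fractional_laplacian.
Context (R : realType) (n : nat) (Om : set 'rV[R]_n).
Variables (lam : nat -> R) (psi : nat -> 'rV[R]_n -> R).
Local Notation mu := (lebesgue_rV R n).
Local Notation L2 := (L2 Om).
Local Notation L2norm := (L2norm Om).

Definition coef (u : 'rV[R]_n -> R) (m : nat) : R := L2inner Om u (psi m).

Definition Hs (s : R) : set ('rV[R]_n -> R) :=
  [set u | L2 u /\ (\sum_(m <oo) (lam m `^ s * coef u m ^+ 2)%:E < +oo)%E].

(* (- Delta_D)^(s/2) u, a representative of the L^2 sum of the series. *)
Definition frac_lap (s : R) (u : 'rV[R]_n -> R) : 'rV[R]_n -> R :=
  get [set v | L2 v /\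
    L2cvg Om (fun k x => \sum_(m < k) lam m `^ (s / 2) * coef u m * psi m x) v].

(* alpha is the regularization parameter; mu denotes the Lebesgue measure. *)
Definition regularizer (alpha s : R) (u : 'rV[R]_n -> R) : \bar R :=
  if `[< Hs s u >] then (alpha%:E * L2norm (frac_lap s u) ^+ 2)%E else +oo%E.

Definition cost (alpha s : R) (v u : 'rV[R]_n -> R) : \bar R :=
  (L2norm (u \- v)%R ^+ 2 + regularizer alpha s u)%E.

Definition minimizer (alpha s : R) (v : 'rV[R]_n -> R) :
    set ('rV[R]_n -> R) :=
  [set w | L2 w /\
     forall u, L2 u -> (cost alpha s v w <= cost alpha s v u)%E].

Definition unique_minimizer (alpha s : R) (v w : 'rV[R]_n -> R) : Prop :=
  minimizer alpha s v w /\
  forall w', minimizer alpha s v w' -> ae_eq mu Om w' w.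

Definition reconstruction (alpha s : R) (v : 'rV[R]_n -> R) : 'rV[R]_n -> R :=
  get (minimizer alpha s v).

Definition upper_level (alpha : R) (N : nat)
    (uc ueta : 'I_N -> 'rV[R]_n -> R) (s : R) : R :=
  \sum_j fine (L2norm (reconstruction alpha s (ueta j) \- uc j)) ^+ 2.

End spectral_fractional_laplacian.

(* Main.v *)
Require Import Defs.
From mathcomp Require Import all_boot all_order all_algebra.
From mathcomp Require Import all_classical all_reals all_analysis.
From mathcomp Require Import measurable_realfun.
From mathcomp Require Import ring lra.

Set Implicit Arguments.
Unset Strict Implicit.
Unset Printing Implicit Defensive.

Import Order.TTheory GRing.Theory Num.Theory.
Import numFieldNormedType.Exports.

Local Open Scope classical_set_scope.
Local Open Scope ring_scope.

(** Write a_m, c_m for the coefficients of a component of ueta and of uc in the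
    eigenbasis psi.  In this basis the Tikhonov functional decouples into the
    parabolas (x - a_m)^2 + alpha lam_m^s x^2, so its minimizer has the
    coefficients a_m / (1 + alpha lam_m^s), and by Parseval the upper-level
    functional is the sum over the components and over m of
      (a_m / (1 + alpha lam_m^s) - c_m)^2.
    This formula makes sense for every real s.  The derivative of the m-th term
    is bounded, uniformly in s, by (ln lam_m a_m)^2 + a_m^2 + c_m^2, because s
    enters it only through 1 / (1 + y) and y / (1 + y)^2 with y = alpha lam_m^s,
    which are at most 1.  As ln lam_m is dominated by a multiple of
    lam_m^(eps / 2), these bounds are summable: ueta lies in H^eps.  So the
    functional extends to a function on the whole line that can be
    differentiated termwise ([is_derive_series]).  The two logarithmic sums are
    negative multiples of its derivatives at 0 and at 1; hence it decreases at 0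
    and increases at 1, and its minimum over [0, 1], which exists by
    compactness, is attained inside ([interior_minimum]).

    The formula for the minimizer rests on the Riesz-Fischer theorem
    ([riesz_fischer]): the series that define the fractional Laplacian and the
    minimizer converge in L^2.  This is a consequence of the completeness of L^2
    ([Lfun2_complete]), proved first, over an arbitrary measure space.  The
    optimality and the uniqueness of the minimizer are read off from a
    completed square ([cost_excess]). *)

(** * Completeness of L^2 *)

Lemma nneseries_EFin (R : realType) (u : nat -> R) :
  cvgn (series u) -> (\sum_(n <oo) (u n)%:E = (limn (series u))%:E)%E.
Proof.
move=> cu; rewrite -EFin_lim//; congr (limn _); apply/funext => n /=.
by rewrite sumEFin.
Qed.

Lemma cvg_nneseries_EFin (R : realType) (u : nat -> R) :
  (forall n, 0 <= u n) ->
  (\sum_(n <oo) (u n)%:E < +oo)%E <-> cvgn (series u).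
Proof.
move=> u0; split=> [|cu]; first exact: nnseries_is_cvg.
by rewrite nneseries_EFin// ltry.
Qed.

Lemma Lnorm2E d (T : measurableType d) (R : realType)
    (mu : {measure set T -> \bar R}) (f : T -> R) :
  f \in Lfun mu 2%:E ->
  'N[mu]_2%:E[EFin \o f]%E = (Num.sqrt (\int[mu]_x (f x ^+ 2)))%:E.
Proof.
move=> Lf; have := Lfun2_integrable_sqr Lf => /integrable_fin_num ifin.
rewrite unlock.
have -> : (\int[mu]_x `|(EFin \o f) x| `^ 2 = (\int[mu]_x (f x ^+ 2))%:E)%E.
  rewrite /Rintegral fineK//; last exact: ifin.
  apply: eq_integral => x _ /=.
  by rewrite powR_mulrn ?normr_ge0// real_normK ?num_real.
by rewrite poweR_EFin powR12_sqrt// Rintegral_ge0// => x _; exact: sqr_ge0.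
Qed.

Lemma Lfun2P d (T : measurableType d) (R : realType)
    (mu : {measure set T -> \bar R}) (f : T -> R) :
  f \in Lfun mu 2%:E <->
  measurable_fun setT f /\ (\int[mu]_x (f x ^+ 2)%:E < +oo)%E.
Proof.
split=> [Lf|[mf f2]].
  split; first by move: Lf; rewrite inE => /andP[/[!inE]].
  have /integrableP[_] := Lfun2_integrable_sqr Lf.
  by under eq_integral do rewrite gee0_abs ?lee_fin ?sqr_ge0//.
rewrite inE; apply/andP; split; rewrite inE//= /finite_norm unlock.
apply: poweR_lty; apply: le_lt_trans f2; rewrite le_eqVlt; apply/orP; left.
apply/eqP; apply: eq_integral => x _ /=.
by rewrite powR_mulrn ?normr_ge0// real_normK ?num_real.
Qed.

(** The increments are at most a constant times 2 ^- i, so that their series is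
    dominated by a geometric one. *)
Lemma cvg_of_quarter_increments (R : realType) (u : nat -> R) :
  (\sum_(i <oo) (4 ^+ i * (u i.+1 - u i) ^+ 2)%:E < +oo)%E -> cvgn u.
Proof.
move=> uoo; set S := (\sum_(i <oo) _)%E in uoo.
have t0 i : (0 <= (4 ^+ i * (u i.+1 - u i) ^+ 2)%:E)%E.
  by rewrite lee_fin mulr_ge0// sqr_ge0.
have S0 : (0 <= S)%E by apply: nneseries_ge0 => i _ _; exact: t0.
have Sfin : S \is a fin_num by rewrite ge0_fin_numE.
have tS i : 4 ^+ i * (u i.+1 - u i) ^+ 2 <= fine S.
  rewrite -lee_fin fineK//.
  apply: le_trans (@nneseries_lim_ge _ _ xpredT 0%N i.+1 _) => //.
  rewrite big_nat_recr//= leeDr// sume_ge0// => k _; exact: t0.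
have dS i : `|u i.+1 - u i| <= geometric (Num.sqrt (fine S)) 2^-1 i.
  rewrite /geometric/= -ler_sqr ?nnegrE//.
  rewrite real_normK ?num_real// exprMn sqr_sqrtr ?fine_ge0//.
  rewrite -exprM mulnC exprM exprVn (_ : 2 ^+ 2 = 4); last by lra.
  by rewrite exprVn ler_pdivlMr ?exprn_gt0// mulrC.
have /normed_cvg cd : cvgn [normed series (telescope u)].
  apply: (@series_le_cvg _ _ (geometric (Num.sqrt (fine S)) 2^-1)).
  - by move=> i; exact: normr_ge0.
  - by move=> i; rewrite /geometric/= mulr_ge0 ?sqrtr_ge0 ?exprn_ge0 ?invr_ge0.
  - by move=> i; exact: dS.
  - by apply: is_cvg_geometric_series; rewrite ger0_norm ?invr_ge0//; lra.
have -> : u = (fun n => u 0%N + series (telescope u) n).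
  by apply/funext => n; rewrite -eq_sum_telescope.
exact: is_cvgD (@is_cvg_cst _ _ _ _ _) cd.
Qed.

Lemma Lfun2_lincomb d (T : measurableType d) (R : realType)
    (mu : {measure set T -> \bar R}) (a : R) (f g : T -> R) :
  f \in Lfun mu 2%:E -> g \in Lfun mu 2%:E ->
  (fun x => a * f x + g x) \in Lfun mu 2%:E.
Proof.
move=> Lf Lg; have [_ H] := @Lfun_submod_closed _ _ _ mu _ (lee1n 2).
exact: H.
Qed.

Lemma Lfun2B d (T : measurableType d) (R : realType)
    (mu : {measure set T -> \bar R}) (f g : T -> R) :
  f \in Lfun mu 2%:E -> g \in Lfun mu 2%:E ->
  (fun x => f x - g x) \in Lfun mu 2%:E.
Proof.
move=> Lf Lg; rewrite (_ : (fun _ => _) = fun x => -1 * g x + f x).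
  exact: Lfun2_lincomb.
by apply/funext => x; rewrite mulN1r addrC.
Qed.

Lemma Lfun2_integral_sqrE d (T : measurableType d) (R : realType)
    (mu : {measure set T -> \bar R}) (f : T -> R) :
  f \in Lfun mu 2%:E ->
  (\int[mu]_x (f x ^+ 2)%:E = (\int[mu]_x (f x ^+ 2))%:E)%E.
Proof.
move=> Lf; rewrite fineK//.
exact: integrable_fin_num (Lfun2_integrable_sqr Lf).
Qed.

(** The limit is found pointwise along a subsequence N whose increments have
    squared norm at most 8 ^- i: weighted by 4 ^ i, their squares still have a
    finite total integral, hence a finite sum almost everywhere, which forces
    convergence there.  Fatou's lemma then turns the Cauchy property into
    convergence in norm.  The limit vanishes wherever all the functions do, so
    that limits of functions supported in a set are supported in this set. *)
Lemma Lfun2_complete d (T : measurableType d) (R : realType)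
    (mu : {measure set T -> \bar R}) (f : nat -> T -> R) :
  (forall k, f k \in Lfun mu 2%:E) ->
  (forall e, 0 < e -> exists K, forall k l, (K <= k)%N -> (K <= l)%N ->
     \int[mu]_x (f k x - f l x) ^+ 2 <= e) ->
  exists g, [/\ g \in Lfun mu 2%:E,
    forall x, (forall k, f k x = 0) -> g x = 0 &
    forall e, 0 < e -> exists K, forall k, (K <= k)%N ->
      \int[mu]_x (f k x - g x) ^+ 2 <= e].
Proof.
move=> Lf fcauchy.
have mf k : measurable_fun setT (f k) by have /Lfun2P[] := Lf k.
have K8 i : {K | forall k l, (K <= k)%N -> (K <= l)%N ->
     \int[mu]_x (f k x - f l x) ^+ 2 <= 8^-1 ^+ i}.
  by apply: cid; apply: fcauchy; rewrite exprn_gt0// invr_gt0.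
(* The sum makes N monotone and its successors make it at least the identity. *)
pose N i := (\sum_(j < i.+1) (sval (K8 j)).+1)%N.
have KN i : (sval (K8 i) <= N i)%N.
  by rewrite /N big_ord_recr/= addnS leqW// leq_addl.
have leN i : (i <= N i)%N.
  elim: i => // i /leq_trans; rewrite {2}/N big_ord_recr/= addnS; apply.
  by rewrite leq_addr.
have NS i : (N i <= N i.+1)%N by rewrite {2}/N big_ord_recr/= leq_addr.
pose d_ i x := 4 ^+ i * (f (N i.+1) x - f (N i) x) ^+ 2.
have md i : measurable_fun setT (EFin \o d_ i).
  apply/measurable_EFinP; apply: measurable_funM => //.
  by apply: measurable_funX; exact: measurable_funB.
have d0 i x : (0 <= (d_ i x)%:E)%E by rewrite lee_fin mulr_ge0// sqr_ge0.
have dint i : (\int[mu]_x (d_ i x)%:E <= (geometric 1 2^-1 i)%:E)%E.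
  under eq_integral do rewrite EFinM.
  rewrite ge0_integralZl//=; last 2 first.
    by apply/measurable_EFinP; apply: measurable_funX; exact: measurable_funB.
    by move=> x _; rewrite lee_fin sqr_ge0.
  rewrite Lfun2_integral_sqrE ?Lfun2B// -EFinM lee_fin /geometric/= mul1r.
  have := (svalP (K8 i)) (N i.+1) (N i) (leq_trans (KN i) (NS i)) (KN i).
  move=> /(ler_wpM2l (exprn_ge0 i (ler0n R 4))) /le_trans; apply.
  by rewrite -exprMn (_ : 4 * 8^-1 = 2^-1)//; lra.
have sumoo : (\int[mu]_x (\sum_(i <oo) (d_ i x)%:E) < +oo)%E.
  rewrite integral_nneseries//.
  apply: (@le_lt_trans _ _ (\sum_(i <oo) (geometric 1 2^-1 i)%:E)%E).
    by apply: lee_nneseries => // i _ _; exact: integral_ge0.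
  apply/cvg_nneseries_EFin; last first.
    by apply: is_cvg_geometric_series; rewrite ger0_norm ?invr_ge0//; lra.
  by move=> i; rewrite /geometric/= mul1r.
have aecvg : {ae mu, forall x, cvgn (fun i => f (N i) x)}.
  have /integrable_ae : mu.-integrable setT (fun x => \sum_(i <oo) (d_ i x)%:E)%E.
    apply/integrableP; split.
      have := @ge0_emeasurable_sum _ _ _ setT (fun i x => (d_ i x)%:E) xpredT.
      by apply=> [i x _ _|i _]; [exact: d0|exact: md].
    under eq_integral do rewrite gee0_abs ?nneseries_ge0//.
    exact: sumoo.
  move=> /(_ measurableT); apply: filterS => x /(_ I) xfin.
  apply: cvg_of_quarter_increments.
  by move: xfin; rewrite ge0_fin_numE// nneseries_ge0.
(* The upper limit is measurable even where the subsequence diverges. *)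
pose g x := fine (limn_esup (fun i => (f (N i) x)%:E)).
have mg : measurable_fun setT g.
  apply: measurableT_comp => //.
  by apply: measurable_fun_limn_esup => i; exact/measurable_EFinP.
have aeg : {ae mu, forall x, (fun i => f (N i) x) @ \oo --> g x}.
  apply: filterS aecvg => x cx.
  have cE : (fun i => (f (N i) x)%:E) @ \oo --> (limn (fun i => f (N i) x))%:E.
    by apply: cvg_EFin => //; exact: nearW.
  by rewrite /g (cvg_limn_einf_sup cE).2/=.
have fatoug e : 0 < e -> exists K, forall k, (K <= k)%N ->
    (\int[mu]_x ((f k x - g x) ^+ 2)%:E <= e%:E)%E.
  move=> e0; have [K HK] := fcauchy _ e0; exists K => k Kk.
  have mh i : measurable_fun setT (EFin \o (fun x => (f k x - f (N i) x) ^+ 2)).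
    by apply/measurable_EFinP; apply: measurable_funX; exact: measurable_funB.
  have -> : (\int[mu]_x ((f k x - g x) ^+ 2)%:E =
      \int[mu]_x limn_einf (fun i => ((f k x - f (N i) x) ^+ 2)%:E))%E.
    apply: ge0_ae_eq_integral => //.
    - by apply/measurable_EFinP; apply: measurable_funX; exact: measurable_funB.
    - rewrite -[X in measurable_fun _ X]/(fun x =>
        - limn_esup (fun i => - ((f k x - f (N i) x) ^+ 2)%:E))%E.
      apply: measurableT_comp => //; apply: measurable_fun_limn_esup => i.
      by apply: measurableT_comp => //; exact: mh.
    - by move=> x _; rewrite lee_fin sqr_ge0.
    - move=> x _; rewrite limn_einf_lim; apply: lime_ge; first exact: is_cvg_einfs.
      apply: nearW => m; apply: le_ereal_inf_tmp => _ [i _ <-].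
      by rewrite lee_fin sqr_ge0.
    apply: filterS aeg => x gx _; apply/esym.
    apply: (cvg_limn_einf_sup _).1; apply: cvg_EFin; first exact: nearW.
    apply: (@cvg_comp _ _ _ (fun i => f k x - f (N i) x) (fun y => y ^+ 2)).
      exact: cvgB (cvg_cst _) gx.
    exact: exprn_continuous.
  apply: (le_trans (fatou _ _ _ _)) => //.
    by move=> i x _; rewrite lee_fin sqr_ge0.
  rewrite limn_einf_lim; apply: lime_le; first exact: is_cvg_einfs.
  apply: nearW => m; pose i := maxn m K.
  apply: (@le_trans _ _ (\int[mu]_x ((f k x - f (N i) x) ^+ 2)%:E)%E).
    by apply: ereal_inf_lbound; exists i => //=; rewrite leq_maxl.
  rewrite Lfun2_integral_sqrE ?Lfun2B// lee_fin HK//.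
  by rewrite (leq_trans _ (leN i))// leq_maxr.
have Lg : g \in Lfun mu 2%:E.
  have [K /(_ K (leqnn _)) HK] := fatoug _ ltr01.
  have : (fun x => f K x - (f K x - g x)) \in Lfun mu 2%:E.
    apply: Lfun2B => //; apply/Lfun2P; split; first exact: measurable_funB.
    by rewrite (le_lt_trans HK)// ltry.
  by rewrite (_ : (fun x => _) = g)//; apply/funext => x; rewrite subKr.
exists g; split => //.
  move=> x fx0; rewrite /g; under eq_fun do rewrite fx0.
  by rewrite (cvg_limn_einf_sup (cvg_cst _)).2.
move=> e /fatoug[K HK]; exists K => k /HK.
by rewrite Lfun2_integral_sqrE ?Lfun2B.
Qed.

(** * The inner product of L^2 over a domain *)

Section L2_space.
Context (R : realType) (n : nat) (Om : set 'rV[R]_n).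
Local Notation mu := (lebesgue_rV R n).
Local Notation L2 := (L2 Om).
Local Notation "<| u , v |>" := (L2inner Om u v) (at level 0, u, v at level 99).
Implicit Types (u v w : 'rV[R]_n -> R) (a b : R).

Lemma patch_lincomb a u v :
  (fun x => a * u x + v x) \_ Om = (fun x => a * (u \_ Om) x + (v \_ Om) x).
Proof.
by apply/funext => x; rewrite !patchE; case: ifP => // _; rewrite mulr0 addr0.
Qed.

(** Extending the functions by zero turns integrals over Om into integrals over
    the whole space, to which the theory of L^p functions applies. *)
Lemma L2innerE u v : <|u, v|> = \int[mu]_x ((u \_ Om) x * (v \_ Om) x).
Proof.
rewrite /L2inner Rintegral_mkcond; apply: eq_Rintegral => x _.
by rewrite !patchE; case: ifP => // _; rewrite mulr0.
Qed.

Lemma L2innerC u v : <|u, v|> = <|v, u|>.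
Proof. by apply: eq_Rintegral => x _; rewrite mulrC. Qed.

Lemma L2inner_ge0 u : 0 <= <|u, u|>.
Proof. by apply: Rintegral_ge0 => x _; exact: sqr_ge0. Qed.

Lemma L2_lincomb a u v : L2 u -> L2 v -> L2 (fun x => a * u x + v x).
Proof. by rewrite /Defs.L2/= patch_lincomb => Lu Lv; exact: Lfun2_lincomb. Qed.

Lemma L2inner_lincomb a u v w : L2 u -> L2 v -> L2 w ->
  <|(fun x => a * u x + v x)%R, w|> = a * <|u, w|> + <|v, w|>.
Proof.
move=> Lu Lv Lw; have Luw := Lfun2_mul_Lfun1 Lu Lw.
have Lvw := Lfun2_mul_Lfun1 Lv Lw.
rewrite !L2innerE patch_lincomb -RintegralZl//; last exact/Lfun1_integrable.
rewrite -RintegralD//; last 2 first.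
- have /Lfun1_integrable := Luw; move=> /(integrableZl measurableT a).
  by apply: eq_integrable.
- exact/Lfun1_integrable.
by apply: eq_Rintegral => x _; rewrite mulrDl mulrA.
Qed.

Lemma L2_0 : L2 (fun=> 0).
Proof.
rewrite /Defs.L2/= (_ : _ \_ _ = cst 0); last first.
  by apply/funext => x; rewrite patchE; case: ifP.
have [H _] := @Lfun_submod_closed _ _ _ mu _ (lee1n 2).
exact: H.
Qed.

Lemma L2B u v : L2 u -> L2 v -> L2 (u \- v).
Proof.
move=> Lu Lv; rewrite (_ : _ \- _ = fun x => -1 * v x + u x).
  exact: L2_lincomb.
by apply/funext => x; rewrite /= mulN1r addrC.
Qed.

Lemma L2inner0 w : L2 w -> <|(fun=> 0)%R, w|> = 0.
Proof.
move=> Lw; rewrite (_ : (fun=> 0) = fun x => -1 * w x + w x).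
  by rewrite L2inner_lincomb// mulN1r addNr.
by apply/funext => x; rewrite mulN1r addNr.
Qed.

Lemma L2innerB u v w : L2 u -> L2 v -> L2 w ->
  <|u \- v, w|> = <|u, w|> - <|v, w|>.
Proof.
move=> Lu Lv Lw; rewrite (_ : u \- v = fun x => -1 * v x + u x).
  by rewrite L2inner_lincomb// mulN1r addrC.
by apply/funext => x; rewrite /= mulN1r addrC.
Qed.

Lemma L2norm_sqrt u : L2 u -> L2norm Om u = (Num.sqrt <|u, u|>)%:E.
Proof. by move=> Lu; rewrite /L2norm Lnorm2E// L2innerE. Qed.

Lemma L2norm_sqr u : L2 u -> (L2norm Om u ^+ 2 = <|u, u|>%:E)%E.
Proof.
by move=> Lu; rewrite L2norm_sqrt// expe2 -EFinM -expr2 sqr_sqrtr// L2inner_ge0.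
Qed.

Lemma L2cvgP (F : nat -> 'rV[R]_n -> R) u : (forall k, L2 (F k)) -> L2 u ->
  L2cvg Om F u <-> <|F k \- u, F k \- u|> @[k --> \oo] --> 0.
Proof.
move=> LF Lu; have LB k : L2 (F k \- u) by exact: L2B.
rewrite /L2cvg (_ : (fun k => _) =
    (EFin \o fun k => Num.sqrt <|F k \- u, F k \- u|>)); last first.
  by apply/funext => k /=; rewrite L2norm_sqrt.
split=> [/fine_cvg F0|F0].
- rewrite (_ : (fun k => _) = fun k => Num.sqrt <|F k \- u, F k \- u|> ^+ 2);
    last first.
    by apply/funext => k; rewrite sqr_sqrtr// L2inner_ge0.
  rewrite -[X in _ --> X](_ : 0 ^+ 2 = 0); last by rewrite expr0n.
  exact: (@cvg_comp _ _ _ _ (fun y : R => y ^+ 2) _ _ _ F0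
    (@exprn_continuous _ 2 _)).
- apply: cvg_EFin; first exact: nearW.
  rewrite -[X in _ --> X]sqrtr0.
  exact: (@cvg_comp _ _ _ _ (@Num.sqrt R) _ _ _ F0 (@sqrt_continuous R 0)).
Qed.

Lemma L2inner_eq0_ae u : L2 u -> <|u, u|> = 0 -> ae_eq mu Om u (fun=> 0).
Proof.
move=> Lu u0; have /Lfun2P[mfu _] := Lu.
have N0 : ('N[mu]_2%:E[EFin \o (u \_ Om)] = 0)%E.
  by rewrite Lnorm2E// -L2innerE u0 sqrtr0.
have mfuE : measurable_fun setT (EFin \o (u \_ Om)) by exact/measurable_EFinP.
have := Lnorm_eq0_eq0 mfuE _ N0; rewrite lte_fin => /(_ (ltr0n _ 2)).
apply: filterS => // x /(_ I) /= + xOm.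
by rewrite patchE mem_set// => -[].
Qed.

Lemma L2_complete (F : nat -> 'rV[R]_n -> R) : (forall k, L2 (F k)) ->
  (forall e, 0 < e -> exists K, forall k l, (K <= k)%N -> (K <= l)%N ->
     <|F k \- F l, F k \- F l|> <= e) ->
  exists2 u, L2 u & L2cvg Om F u.
Proof.
have innerB u v : <|u \- v, u \- v|> =
    \int[mu]_x ((u \_ Om) x - (v \_ Om) x) ^+ 2.
  rewrite L2innerE; apply: eq_Rintegral => x _ /=.
  by rewrite !patchE; case: ifP => // _; rewrite mulr0 subr0 expr0n.
move=> LF cF; have [|g [Lg g0 Fg]] := Lfun2_complete LF.
  by move=> e /cF[K HK]; exists K => k l Kk Kl; rewrite -innerB HK.
have gE : g \_ Om = g.
  apply/funext => x; rewrite patchE; case: ifPn => // /negbTE xOm.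
  by rewrite g0// => k; rewrite patchE xOm.
have LG : L2 g by rewrite /Defs.L2/= gE.
exists g => //; apply/L2cvgP => //.
apply/cvgrPdist_le => e e0; have [K HK] := Fg _ e0.
near=> k; rewrite sub0r normrN ger0_norm ?L2inner_ge0// innerB gE HK//.
by near: k; exact: nbhs_infty_ge.
Unshelve. all: by end_near. Qed.

End L2_space.

(** * Fourier series in an orthonormal basis *)

Section fourier_series.
Context (R : realType) (n : nat) (Om : set 'rV[R]_n) (psi : nat -> 'rV[R]_n -> R).
Context (psi_basis : orthonormal_basis Om psi).
Local Notation L2 := (L2 Om).
Local Notation "<| u , v |>" := (L2inner Om u v) (at level 0, u, v at level 99).
Local Notation coef := (coef Om psi).
Implicit Types (u v w : 'rV[R]_n -> R) (b : nat -> R).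

Definition fourier_sum b k : 'rV[R]_n -> R := fun x => \sum_(m < k) b m * psi m x.

Let L2psi m : L2 (psi m). Proof. by case: psi_basis. Qed.

Lemma fourier_sumS b k :
  fourier_sum b k.+1 = fun x => b k * psi k x + fourier_sum b k x.
Proof. by apply/funext => x; rewrite /fourier_sum big_ord_recr addrC. Qed.

Lemma fourier_sum0 b : fourier_sum b 0 = fun=> 0.
Proof. by apply/funext => x; rewrite /fourier_sum big_ord0. Qed.

Lemma L2_fourier_sum b k : L2 (fourier_sum b k).
Proof.
elim: k => [|k IH]; first by rewrite fourier_sum0; exact: L2_0.
by rewrite fourier_sumS; exact: L2_lincomb.
Qed.

Lemma L2inner_fourier_sum b k w : L2 w ->
  <|fourier_sum b k, w|> = \sum_(m < k) b m * coef w m.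
Proof.
move=> Lw; elim: k => [|k IH]; first by rewrite fourier_sum0 L2inner0// big_ord0.
rewrite fourier_sumS L2inner_lincomb//; last exact: L2_fourier_sum.
by rewrite big_ord_recr/= IH addrC L2innerC.
Qed.

Lemma coef_fourier_sum b k m :
  coef (fourier_sum b k) m = if (m < k)%N then b m else 0.
Proof.
have orth i j : <|psi i, psi j|> = (i == j)%:R by case: psi_basis.
rewrite {1}/Defs.coef L2inner_fourier_sum//.
under eq_bigr do rewrite /Defs.coef orth.
case: ifPn => mk.
  rewrite (bigD1 (Ordinal mk))//= eqxx mulr1 big1 ?addr0// => i /eqP im.
  by case: eqP => [mi|]; [case: im; apply/val_inj|rewrite mulr0].
rewrite big1// => i _; case: eqP => [mi|]; last by rewrite mulr0.
by rewrite mi ltn_ord in mk.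
Qed.

(** Pythagoras: Bessel's inequality, Parseval's identity, the Cauchy property of
    Fourier series and the identification of their coefficients are all
    instances of this formula. *)
Lemma sqr_dist_fourier_sum b k u : L2 u ->
  <|u \- fourier_sum b k, u \- fourier_sum b k|> =
  <|u, u|> - \sum_(m < k) coef u m ^+ 2 + \sum_(m < k) (coef u m - b m) ^+ 2.
Proof.
move=> Lu; have LS := L2_fourier_sum b k; have LuS := L2B Lu LS.
have SS : <|fourier_sum b k, fourier_sum b k|> = \sum_(m < k) b m ^+ 2.
  rewrite L2inner_fourier_sum//; apply: eq_bigr => m _.
  by rewrite coef_fourier_sum ltn_ord.
rewrite L2innerB// [<|u, _|>]L2innerC [<|_, u \- _|>]L2innerC !L2innerB//.
rewrite [<|u, fourier_sum _ _|>]L2innerC SS L2inner_fourier_sum//.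
have -> : \sum_(m < k) (coef u m - b m) ^+ 2 = \sum_(m < k) coef u m ^+ 2
    - \sum_(m < k) b m * coef u m - \sum_(m < k) b m * coef u m
    + \sum_(m < k) b m ^+ 2.
  by rewrite -!sumrB -big_split/=; apply: eq_bigr => m _; ring.
ring.
Qed.

Lemma parseval u : L2 u -> series (fun m => coef u m ^+ 2) @ \oo --> <|u, u|>.
Proof.
move=> Lu; have [_ _ /(_ _ Lu)] := psi_basis.
move=> /(L2cvgP (L2_fourier_sum (coef u)) Lu) q0.
rewrite (_ : series _ = fun k => <|u, u|> -
  <|fourier_sum (coef u) k \- u, fourier_sum (coef u) k \- u|>); last first.
  apply/funext => k; rewrite seriesEord/=.
  rewrite (_ : <| _ \- u, _|> =
     <|u \- fourier_sum (coef u) k, u \- fourier_sum (coef u) k|>).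
    rewrite sqr_dist_fourier_sum// [\sum_(m < k) (_ - _) ^+ 2]big1 ?addr0; last first.
      by move=> i _; rewrite subrr expr0n.
    by rewrite subKr.
  by apply: eq_Rintegral => x _ /=; ring.
by rewrite -[X in _ --> X]subr0; exact: cvgB (cvg_cst _) q0.
Qed.

Lemma parsevalE u : L2 u -> <|u, u|> = limn (series (fun m => coef u m ^+ 2)).
Proof. by move=> /parseval/cvg_lim ->. Qed.

Lemma bessel u k : L2 u -> \sum_(m < k) coef u m ^+ 2 <= <|u, u|>.
Proof.
move=> Lu; have cu := parseval Lu; rewrite (parsevalE Lu).
rewrite -(big_mkord xpredT (fun m => coef u m ^+ 2)).
apply: (@nondecreasing_cvgn_le _ (series (fun m => coef u m ^+ 2))).
  by apply: nondecreasing_series => m _ _; exact: sqr_ge0.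
by apply/cvg_ex; eexists; exact: cu.
Qed.

(** By the distance formula and Bessel's inequality, the square of
    coef v m - b m is at most the squared distance from v to any sum of more
    than m terms. *)
Lemma coef_L2cvg b v : L2 v -> L2cvg Om (fourier_sum b) v -> coef v =1 b.
Proof.
move=> Lv /(L2cvgP (L2_fourier_sum b) Lv) bv m.
apply/eqP; rewrite -subr_eq0 -sqrf_eq0 eq_le sqr_ge0 andbT.
rewrite -(cvg_lim _ bv)//; apply: limr_ge; first by apply/cvg_ex; exists 0.
exists m.+1 => // k /= mk.
rewrite (_ : <| _ \- v, _|> = <|v \- fourier_sum b k, v \- fourier_sum b k|>).
  have : (coef v m - b m) ^+ 2 <= \sum_(i < k) (coef v i - b i) ^+ 2.
    by rewrite (bigD1 (Ordinal mk))//= lerDl sumr_ge0// => i _; exact: sqr_ge0.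
  by have := bessel k Lv; rewrite sqr_dist_fourier_sum//; lra.
by apply: eq_Rintegral => x _ /=; ring.
Qed.

(** The squared distance of two partial sums is a difference of partial sums of
    the series of squares. *)
Lemma riesz_fischer b : cvgn (series (fun m => b m ^+ 2)) ->
  exists2 v, L2 v & L2cvg Om (fourier_sum b) v.
Proof.
move=> cb; apply: L2_complete; first exact: L2_fourier_sum.
pose S := fourier_sum b.
have distC k l : <|S k \- S l, S k \- S l|> = <|S l \- S k, S l \- S k|>.
  by apply: eq_Rintegral => x _ /=; ring.
have dist k l : (l <= k)%N ->
    <|S k \- S l, S k \- S l|> =
    series (fun m => b m ^+ 2) k - series (fun m => b m ^+ 2) l.
  move=> lk; rewrite !seriesEord/= /S sqr_dist_fourier_sum; last first.
    exact: L2_fourier_sum.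
  rewrite [\sum_(m < l) (_ - _) ^+ 2]big1 ?addr0; last first.
    move=> i _; rewrite coef_fourier_sum (leq_trans (ltn_ord i) lk).
    by rewrite subrr expr0n.
  rewrite L2inner_fourier_sum; last exact: L2_fourier_sum.
  congr (_ - _); apply: eq_bigr => i _; rewrite coef_fourier_sum.
    by rewrite ltn_ord.
  by rewrite (leq_trans (ltn_ord i) lk).
move=> e e0; have e2 := divr_gt0 e0 (ltr0n R 2).
have /cvg_ex[s /cvgrPdist_lt/(_ _ e2)[K _ HK]] := cb.
exists K => k l /HK/= sk /HK/= sl.
wlog lk : k l sk sl / (l <= k)%N.
  move=> H; case: (leqP l k) => [|/ltnW] /H; first exact.
  by rewrite -/(S l) distC; exact.
rewrite dist//; move: sk sl; rewrite !ltr_norml => /andP[? ?] /andP[? ?].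
lra.
Qed.

Lemma coef_eq_ae u v : L2 u -> L2 v -> coef u =1 coef v ->
  ae_eq (lebesgue_rV R n) Om u v.
Proof.
move=> Lu Lv uv; have Luv := L2B Lu Lv.
have q0 : <|u \- v, u \- v|> = 0.
  rewrite parsevalE// (_ : series _ = cst 0) ?lim_cst//.
  apply/funext => k; rewrite seriesEord/= big1// => m _.
  by rewrite {1}/Defs.coef L2innerB// -/(coef u m) uv subrr expr0n.
apply: filterS (L2inner_eq0_ae Luv q0) => x + xOm => /(_ xOm)/= /eqP.
by rewrite subr_eq0 => /eqP.
Qed.

End fourier_series.

(** * The minimizer of the regularized problem *)

Section tikhonov.
Context (R : realType) (n : nat) (Om : set 'rV[R]_n).
Context (lam : nat -> R) (psi : nat -> 'rV[R]_n -> R).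
Context (psi_basis : orthonormal_basis Om psi).
Context (lam_gt0 : forall m, 0 < lam m).
Local Notation L2 := (L2 Om).
Local Notation "<| u , v |>" := (L2inner Om u v) (at level 0, u, v at level 99).
Local Notation coef := (coef Om psi).
Local Notation Hs := (Hs Om lam psi).
Implicit Types (u v w : 'rV[R]_n -> R) (s : R).

Lemma coefB u v m : L2 u -> L2 v -> coef (u \- v) m = coef u m - coef v m.
Proof. by move=> Lu Lv; rewrite /Defs.coef L2innerB//; case: psi_basis. Qed.

Lemma HsP s u :
  Hs s u <-> L2 u /\ cvgn (series (fun m => lam m `^ s * coef u m ^+ 2)).
Proof.
have t0 m : 0 <= lam m `^ s * coef u m ^+ 2.
  by rewrite mulr_ge0 ?powR_ge0 ?sqr_ge0.
by split=> -[Lu] /(cvg_nneseries_EFin t0).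
Qed.

(** The series that defines the fractional Laplacian converges by Riesz-Fischer,
    since its coefficients have the squares lam m `^ s * coef u m ^+ 2; so the
    choice made in [frac_lap] is a genuine limit. *)
Lemma frac_lap_norm s u : Hs s u ->
  (L2norm Om (frac_lap Om lam psi s u) ^+ 2 =
   (limn (series (fun m => lam m `^ s * coef u m ^+ 2)))%:E)%E.
Proof.
move=> /HsP[Lu cu]; set b := fun m => lam m `^ (s / 2) * coef u m.
have bE : (fun m => b m ^+ 2) = fun m => lam m `^ s * coef u m ^+ 2.
  have half m : (lam m `^ (s / 2)) ^+ 2 = lam m `^ s.
    by rewrite -powR_mulrn ?powR_ge0// -powRrM mulfVK.
  by apply/funext => m; rewrite /b exprMn half.
have [|v Lv bv] := riesz_fischer psi_basis (b := b); first by rewrite bE.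
have [Lf bf] : L2 (frac_lap Om lam psi s u) /\
    L2cvg Om (fourier_sum psi b) (frac_lap Om lam psi s u).
  apply: (@getPex _ [set v | L2 v /\ L2cvg Om (fourier_sum psi b) v]).
  by exists v.
rewrite L2norm_sqr// (parsevalE psi_basis)// -bE; congr (limn (series _))%:E.
by apply/funext => m; rewrite (coef_L2cvg psi_basis Lf bf).
Qed.

Context (alpha : R) (alpha_gt0 : 0 < alpha).
Local Notation cost := (cost Om lam psi alpha).
Local Notation minimizer := (minimizer Om lam psi alpha).
Local Notation damping s m := (1 + alpha * lam m `^ s).

(** The cost splits into these contributions of the modes. *)
Definition energy s v u m : R :=
  (coef u m - coef v m) ^+ 2 + alpha * (lam m `^ s * coef u m ^+ 2).

Lemma cvg_energy s v u : L2 v -> Hs s u -> cvgn (series (energy s v u)).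
Proof.
move=> Lv /HsP[Lu cu]; apply: is_cvg_seriesD; last exact: is_cvg_seriesZ.
rewrite (_ : series _ = series (fun m => coef (u \- v) m ^+ 2)).
  by apply/cvg_ex; eexists; exact: (parseval psi_basis (L2B Lu Lv)).
by congr series; apply/funext => m; rewrite coefB.
Qed.

Lemma cost_Hs s v u : L2 v -> Hs s u ->
  cost s v u = (limn (series (energy s v u)))%:E.
Proof.
move=> Lv Hu; have /HsP[Lu cu] := Hu.
rewrite /Defs.cost /regularizer asboolT// frac_lap_norm// L2norm_sqr; last first.
  exact: L2B.
rewrite (parsevalE psi_basis (L2B Lu Lv)) -EFinM -EFinD; congr EFin.
have <- : limn (series (alpha *: (fun m => lam m `^ s * coef u m ^+ 2))) =
    alpha * limn (series (fun m => lam m `^ s * coef u m ^+ 2)).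
  exact: lim_seriesZ.
rewrite -lim_seriesD; last 2 first.
- by apply/cvg_ex; eexists; exact: (parseval psi_basis (L2B Lu Lv)).
- exact: is_cvg_seriesZ.
by congr (limn (series _)); apply/funext => m; rewrite /energy -coefB.
Qed.

Lemma cost_notin_Hs s v u : L2 u -> L2 v -> ~ Hs s u -> cost s v u = +oo%E.
Proof.
move=> Lu Lv Hu; rewrite /Defs.cost /regularizer asboolF//.
by rewrite L2norm_sqr//; exact: L2B.
Qed.

Lemma damping_ge1 s m : 1 <= damping s m.
Proof. by rewrite lerDl mulr_ge0 ?powR_ge0// ltW. Qed.

Lemma damping_gt0 s m : 0 < damping s m.
Proof. exact: lt_le_trans ltr01 (damping_ge1 s m). Qed.

(** For the membership in H^s, alpha lam^s / (1 + alpha lam^s)^2 is at most 1. *)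
Lemma damped_exists s v : L2 v ->
  exists2 w, Hs s w & forall m, coef w m = coef v m / damping s m.
Proof.
move=> Lv; pose b m := coef v m / damping s m.
have cv : cvgn (series (fun m => coef v m ^+ 2)).
  by apply/cvg_ex; eexists; exact: (parseval psi_basis Lv).
have [|w Lw bw] := riesz_fischer psi_basis (b := b).
  apply: (series_le_cvg _ _ _ cv) => m; [exact: sqr_ge0|exact: sqr_ge0|].
  rewrite /b exprMn ler_piMr ?sqr_ge0// exprVn invf_le1 ?exprn_gt0 ?damping_gt0//.
  by rewrite exprn_ege1// damping_ge1.
have wE := coef_L2cvg psi_basis Lw bw; exists w => //; apply/HsP; split=> //.
apply: (@series_le_cvg _ _ (fun m => alpha^-1 * coef v m ^+ 2)) => [m|m|m|].
- by rewrite mulr_ge0 ?powR_ge0 ?sqr_ge0.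
- by rewrite mulr_ge0 ?sqr_ge0// invr_ge0 ltW.
- rewrite wE /b exprMn mulrCA mulrC ler_wpM2r ?sqr_ge0//.
  rewrite exprVn ler_pdivrMr ?exprn_gt0 ?damping_gt0// ler_pdivlMl//.
  have := powR_gt0 s (lam_gt0 m); move: (lam m `^ s) => l l0.
  by have := mulr_gt0 alpha_gt0 l0; move: (alpha * l) => y y0; nra.
- exact: is_cvg_seriesZ cv.
Qed.

(** Completing the square mode by mode: with w = v / q and q = 1 + alpha lam^s,
    (u - v)^2 + alpha lam^s u^2 exceeds its value at u = w by q (u - w)^2, and q
    is at least 1. *)
Lemma cost_excess s v u w : L2 v -> Hs s u -> Hs s w ->
  (forall m, coef w m = coef v m / damping s m) ->
  (cost s v w + <|u \- w, u \- w|>%:E <= cost s v u)%E.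
Proof.
move=> Lv Hu Hw wE; have [[Lu _] [Lw _]] := (Hu, Hw).
have cuw := parseval psi_basis (L2B Lu Lw).
have ccuw : cvgn (series (fun m => coef (u \- w) m ^+ 2)).
  by apply/cvg_ex; eexists; exact: cuw.
rewrite !cost_Hs// -EFinD lee_fin (parsevalE psi_basis (L2B Lu Lw)).
have cw := cvg_energy Lv Hw.
rewrite -lim_seriesD//.
apply: lim_series_le; [exact: is_cvg_seriesD|exact: cvg_energy|].
move=> m; rewrite -[leLHS]/(energy s v w m + coef (u \- w) m ^+ 2).
rewrite coefB// /energy.
have -> : coef v m = damping s m * coef w m.
  by rewrite wE mulrC divfK// gt_eqF// damping_gt0.
have := powR_gt0 s (lam_gt0 m); move: (lam m `^ s) => l l0.
have := mulr_ge0 (ltW (mulr_gt0 alpha_gt0 l0)) (sqr_ge0 (coef u m - coef w m)).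
rewrite -[_ <= _ + alpha * _]subr_ge0.
rewrite (_ : _ + _ - _ = alpha * l * (coef u m - coef w m) ^+ 2)//; ring.
Qed.

Lemma minimizer_coef s v w : L2 v ->
  minimizer s v w <-> L2 w /\ forall m, coef w m = coef v m / damping s m.
Proof.
move=> Lv; have [w0 Hw0 w0E] := damped_exists s Lv; have [Lw0 _] := Hw0.
have finw0 : (cost s v w0 < +oo)%E by rewrite cost_Hs// ltry.
split=> [[Lw wmin]|[Lw wE]].
  have Hw : Hs s w.
    apply: contrapT => /(cost_notin_Hs Lw Lv) wy.
    by have := wmin _ Lw0; rewrite wy leye_eq => /eqP w0y; rewrite w0y in finw0.
  split=> // m; rewrite -w0E.
  have := le_trans (cost_excess Lv Hw Hw0 w0E) (wmin _ Lw0).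
  rewrite cost_Hs// -EFinD lee_fin gerDl => q0.
  apply/eqP; rewrite -subr_eq0 -coefB// -sqrf_eq0 eq_le sqr_ge0 andbT.
  have := bessel psi_basis m.+1 (L2B Lw Lw0); rewrite big_ord_recr/=.
  have : 0 <= \sum_(i < m) coef (w \- w0) i ^+ 2.
    by apply: sumr_ge0 => i _; exact: sqr_ge0.
  lra.
have Hw : Hs s w.
  apply/HsP; split=> //; have /HsP[_] := Hw0.
  by congr (cvgn (series _)); apply/funext => m; rewrite wE w0E.
split=> [|u Lu]; first exact: Lw.
have [Hu|Hu] := pselect (Hs s u); last by rewrite (cost_notin_Hs Lu Lv Hu) leey.
by apply: le_trans (cost_excess Lv Hu Hw wE); rewrite leeDl ?lee_fin ?L2inner_ge0.
Qed.

Lemma reconstruction_minimizer s v : L2 v ->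
  minimizer s v (reconstruction Om lam psi alpha s v).
Proof.
move=> Lv; have [w Hw wE] := damped_exists s Lv; have [Lw _] := Hw.
by apply: getPex; exists w; apply/minimizer_coef.
Qed.

Lemma reconstruction_unique s v : L2 v ->
  unique_minimizer Om lam psi alpha s v (reconstruction Om lam psi alpha s v).
Proof.
move=> Lv; have rmin := reconstruction_minimizer s Lv.
split=> // w /(minimizer_coef _ _ Lv)[Lw wE].
have [Lr rE] := (minimizer_coef _ _ Lv).1 rmin.
by apply: (coef_eq_ae psi_basis) => // m; rewrite wE rE.
Qed.

Lemma upper_levelE N (uc ueta : 'I_N -> 'rV[R]_n -> R) s :
  (forall j, L2 (uc j)) -> (forall j, L2 (ueta j)) ->
  upper_level Om lam psi alpha uc ueta s =
  \sum_j limn (series (fun m =>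
    (coef (ueta j) m / damping s m - coef (uc j) m) ^+ 2)).
Proof.
move=> Lc La; apply: eq_bigr => j _.
have [Lr rE] := (minimizer_coef _ _ (La j)).1 (reconstruction_minimizer s (La j)).
have LB := L2B Lr (Lc j).
rewrite L2norm_sqrt//= sqr_sqrtr ?L2inner_ge0// (parsevalE psi_basis)//.
by congr (limn (series _)); apply/funext => m; rewrite coefB// rE.
Qed.

End tikhonov.

(** * Termwise differentiation and interior minima *)

Lemma series_tail_le (R : realType) (u M : nat -> R) (K : nat) :
  (forall m, `|u m| <= M m) -> cvgn (series M) ->
  `|limn (series u) - series u K| <= limn (series M) - series M K.
Proof.
move=> uM cM; have cu : cvgn (series u).
  apply: normed_cvg; apply: series_le_cvg cM => m; [exact: normr_ge0| |exact: uM].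
  exact: le_trans (normr_ge0 _) (uM m).
have cc (v : nat -> R) : cvgn (series v) ->
    (series v k - series v K) @[k --> \oo] --> limn (series v) - series v K.
  by move=> cv; apply: cvgB; [exact: cv|exact: cvg_cst].
have cnu : `|series u k - series u K| @[k --> \oo] -->
    `|limn (series u) - series u K|.
  exact: cvg_norm (cc _ cu).
rewrite -(cvg_lim _ cnu)// -(cvg_lim _ (cc _ cM))//; apply: ler_lim.
- by apply/cvg_ex; eexists; exact: cnu.
- by apply/cvg_ex; eexists; exact: cc cM.
exists K => // k /= Kk; rewrite !sub_series_geq//.
by apply: le_trans (ler_norm_sum _ _ _) _; apply: ler_sum => m _.
Qed.

(** Dominated convergence for series: the tails are small uniformly in t, and
    finite sums commute with limits. *)
Lemma tannery (R : realType) (T : Type) (F : set_system T)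
    {FF : ProperFilter F} (g : nat -> T -> R) (l M : nat -> R) :
  (forall m, g m t @[t --> F] --> l m) ->
  (\forall t \near F, forall m, `|g m t| <= M m) ->
  cvgn (series M) ->
  limn (series (g^~ t)) @[t --> F] --> limn (series l).
Proof.
move=> gl gM cM.
have lM m : `|l m| <= M m.
  rewrite -(cvg_lim _ (cvg_norm (gl m)))//; apply: limr_le.
    by apply/cvg_ex; eexists; exact: cvg_norm (gl m).
  by apply: filterS gM => t /(_ m).
apply/cvgrPdist_le => e e0; have e3 : 0 < e / 3 by rewrite divr_gt0.
have [K _ /(_ K (leqnn _))/= MK] := (cvgrPdist_le _ _).1 cM _ e3.
have glK : series (g^~ t) K @[t --> F] --> series l K.
  rewrite /series/=; under eq_cvg do rewrite big_mkord.
  by rewrite big_mkord; apply: cvg_big => //; exact: add_continuous.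
have glKe := (cvgrPdist_le _ _).1 glK _ e3; near=> t.
have gtM : forall m, `|g m t| <= M m by near: t.
have glt : `|series l K - series (g^~ t) K| <= e / 3 by near: t; exact: glKe.
have := series_tail_le K lM cM; have := series_tail_le K gtM cM.
move: MK glt; rewrite !ler_norml => /andP[? ?] /andP[? ?] /andP[? ?] /andP[? ?].
by apply/andP; split; lra.
Unshelve. all: by end_near. Qed.

Lemma bounded_derive_lipschitz (R : realType) (f f' : R -> R) (M x y : R) :
  (forall z : R, is_derive z 1 f (f' z)) -> (forall z, `|f' z| <= M) ->
  `|f y - f x| <= M * `|y - x|.
Proof.
move=> df fM; wlog xy : x y / x <= y.
  move=> H; have [xy|/ltW yx] := leP x y; first exact: H.
  by rewrite distrC [`|y - x|]distrC; exact: H.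
have cf : {within `[x, y], continuous f}.
  by apply: derivable_within_continuous => z _; case: (df z).
have [c _ ->] := MVT_segment xy (fun z _ => df z) cf.
by rewrite normrM ler_wpM2r.
Qed.

(** Dominated convergence applies to the difference quotients, which the mean
    value theorem bounds by the same constants as the derivatives. *)
Lemma is_derive_series (R : realType) (f f' : nat -> R -> R) (M : nat -> R)
    (x : R) :
  (forall m (y : R), is_derive y 1 (f m) (f' m y)) ->
  (forall m y, `|f' m y| <= M m) -> cvgn (series M) ->
  (forall y, cvgn (series (f^~ y))) ->
  is_derive x 1 (fun y => limn (series (f^~ y))) (limn (series (f'^~ x))).
Proof.
move=> df fM cM cf; set F := fun y => _.
suff H : (h^-1 *: (F (h *: 1 + x) - F x)) @[h --> 0^'] -->
    limn (series (f'^~ x)).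
  by apply: DeriveDef; [apply/cvg_ex; eexists; exact: H|exact: cvg_lim H].
have qE h : h^-1 *: (F (h *: 1 + x) - F x) =
    limn (series (fun m => h^-1 *: (f m (h *: 1 + x) - f m x))).
  rewrite /F -lim_seriesB// -lim_seriesZ//; exact: is_cvg_seriesB.
under eq_cvg do rewrite qE.
apply: (tannery (M := M)) => //.
- move=> m; have [dfm <-] := df m x; exact: dfm.
- near=> h => m; have h0 : h != 0 by near: h; exact: nbhs_dnbhs_neq.
  have := bounded_derive_lipschitz x (h *: 1 + x) (df m) (fM m).
  rewrite normrM normfV ler_pdivrMl ?normr_gt0// mulrC.
  by rewrite [h *: 1]mulr1 addrK.
Unshelve. all: by end_near. Qed.

(** At a minimum over [a, b] located at a, the difference quotients to the right
    would be nonnegative, and so would F' a; symmetrically at b. *)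
Lemma interior_minimum (R : realType) (F F' : R -> R) (a b : R) : a < b ->
  (forall x : R, is_derive x 1 F (F' x)) -> F' a < 0 -> 0 < F' b ->
  exists2 c, a < c < b & forall x, a < x < b -> F c <= F x.
Proof.
move=> ab dF Fa Fb.
have cF : {within `[a, b], continuous F}.
  by apply: derivable_within_continuous => z _; case: (dF z).
have [c] := EVT_min (ltW ab) cF; rewrite in_itv/= => /andP[ac cb] cmin.
have inab x : a <= x <= b -> F c <= F x by move=> xab; apply: cmin; rewrite in_itv.
have quot x : (h^-1 *: (F (h *: 1 + x) - F x)) @[h --> 0^'] --> F' x.
  by have [dFx <-] := dF x.
exists c; last by move=> x /andP[ax xb]; rewrite inab// !ltW.
have ca : c != a.
  apply/eqP => ca; move: Fa; apply/negP; rewrite -leNgt.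
  have q := cvg_dnbhs_at_right (quot a).
  rewrite -(cvg_lim _ q)//; apply: limr_ge.
    by apply/cvg_ex; eexists; exact: q.
  near=> h; have h0 : 0 < h by near: h; exact: nbhs_right_gt.
  have hb : h < b - a by near: h; apply: nbhs_right_lt; rewrite subr_gt0.
  rewrite mulr_ge0 ?invr_ge0 ?(ltW h0)// subr_ge0 -{1}ca inab// [h *: 1]mulr1.
  by apply/andP; split; lra.
have cb' : c != b.
  apply/eqP => cb'; move: Fb; apply/negP; rewrite -leNgt.
  have q := cvg_dnbhs_at_left (quot b).
  rewrite -(cvg_lim _ q)//; apply: limr_le.
    by apply/cvg_ex; eexists; exact: q.
  near=> h; have h0 : h < 0 by near: h; exact: nbhs_left_lt.
  have hb : a - b < h by near: h; apply: nbhs_left_gt; rewrite subr_lt0.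
  rewrite mulr_le0_ge0 ?invr_le0 ?(ltW h0)// subr_ge0 -{1}cb' inab// [h *: 1]mulr1.
  by apply/andP; split; lra.
by rewrite !lt_neqAle ac cb eq_sym ca cb'.
Unshelve. all: by end_near. Qed.

(** * The error as a function of the exponent *)

(** The squared error contributed by one mode, of eigenvalue l: a and c are the
    coefficients of the data and of the clean image. *)
Definition residual (R : realType) (alpha l a c s : R) : R :=
  (a / (1 + alpha * l `^ s) - c) ^+ 2.

(** The derivative of the residual, arranged so that its values at 0 and 1 are
    multiples of the terms of the two logarithmic sums. *)
Definition dresidual (R : realType) (alpha l a c s : R) : R :=
  - (2 * alpha) * (ln l * l `^ s / (1 + alpha * l `^ s) ^+ 3 * a *
                   (a - (1 + alpha * l `^ s) * c)).

Lemma is_derive_residual (R : realType) (alpha l a c s : R) :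
  0 < alpha -> 0 < l ->
  is_derive s 1 (residual alpha l a c) (dresidual alpha l a c s).
Proof.
move=> alpha0 l0.
have dE : is_derive s 1 (fun t : R => l `^ t) (ln l * l `^ s).
  rewrite (_ : (fun t => _) = expR \o (fun t => ln l * t)).
    have dlin : is_derive s 1 (fun t : R => ln l * t) (ln l).
      have := is_deriveZ (ln l) (is_derive_id s (1 : R)).
      by rewrite [_ *: 1]mulr1; exact.
    apply: is_derive_eq.
    by rewrite /powR gt_eqF//= [s * _]mulrC [RHS]mulrC.
  by apply/funext => t /=; rewrite /powR gt_eqF// mulrC.
pose q t := 1 + alpha * l `^ t.
have q0 t : 0 < q t by rewrite addr_gt0// mulr_gt0// powR_gt0.
have dq : is_derive s 1 q (alpha * (ln l * l `^ s)).
  have := is_deriveD (is_derive_cst (1 : R) s (1 : R)) (is_deriveZ alpha dE).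
  by rewrite add0r; exact.
have dqV : is_derive s 1 (fun t => (q t)^-1)
    (- (q s) ^- 2 * (alpha * (ln l * l `^ s))).
  by apply: is_deriveV => //; rewrite gt_eqF.
pose r : R -> R := (a \*: (fun t => (q t)^-1)) - cst c.
have dr := is_deriveB (is_deriveZ a dqV) (is_derive_cst c s (1 : R)).
have -> : residual alpha l a c = r ^+ 2 by apply/funext => t; rewrite exprfctE.
apply: (is_derive_eq (is_deriveX 2 dr)).
rewrite subr0 /dresidual -/(q s) expr1.
rewrite -[_ *: _]/(2 * (a * (q s)^-1 - c) *
  (a * (- (q s) ^- 2 * (alpha * (ln l * l `^ s))))).
have : q s != 0 by rewrite gt_eqF.
by move: (q s) => Q Q0; field.
Qed.

(** With y = alpha l^s, the derivative is the product of - 2 y / (1 + y)^2, which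
    is at most 1 in absolute value, and (ln l a) (a / (1 + y) - c). *)
Lemma dresidual_le (R : realType) (alpha l a c s : R) : 0 < alpha -> 0 < l ->
  `|dresidual alpha l a c s| <= (ln l * a) ^+ 2 + a ^+ 2 + c ^+ 2.
Proof.
move=> alpha0 l0; rewrite /dresidual.
have := mulr_gt0 alpha0 (powR_gt0 s l0); set y := alpha * l `^ s => y0.
have y1 : 1 + y != 0 by rewrite gt_eqF// addr_gt0.
have -> :
    - (2 * alpha) * (ln l * l `^ s / (1 + y) ^+ 3 * a * (a - (1 + y) * c)) =
    - (2 * y / (1 + y) ^+ 2) * ((ln l * a) * (a / (1 + y) - c)).
  by rewrite /y; field.
rewrite normrM normrN; apply: (@le_trans _ _ (1 * `|ln l * a * (a / (1 + y) - c)|)).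
  rewrite ler_wpM2r// ger0_norm; last by rewrite divr_ge0 ?sqr_ge0// mulr_ge0// ltW.
  by rewrite ler_pdivrMr ?exprn_gt0 ?addr_gt0//; nra.
rewrite mul1r; have r1 : (a / (1 + y)) ^+ 2 <= a ^+ 2.
  rewrite exprMn ler_piMr ?sqr_ge0// exprVn invf_le1 ?exprn_gt0 ?addr_gt0//.
  by rewrite exprn_ege1// lerDl ltW.
move: (a / (1 + y)) r1 => r r1; move: (ln l * a) => x.
have := sqr_ge0 (x - (r - c)); have := sqr_ge0 (x + (r - c)).
have := sqr_ge0 (r + c).
by rewrite ler_norml => ? ? ?; apply/andP; split; nra.
Qed.

(** With t = l / l0, which is at least 1, and h = e / 2, ln l = ln l0 + ln t is
    bounded by `|ln l0| + t^h / h, hence by (`|ln l0| + 1 / h) t^h. *)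
Lemma ln_sqr_le_powR (R : realType) (l0 e : R) : 0 < l0 -> 0 < e ->
  exists2 C, 0 <= C & forall l, l0 <= l -> ln l ^+ 2 <= C * l `^ e.
Proof.
move=> l00 e0; pose h := e / 2; have h0 : 0 < h by rewrite divr_gt0.
pose B := `|ln l0| + h^-1.
have B0 : 0 <= B by rewrite addr_ge0// invr_ge0 ltW.
exists (B ^+ 2 / l0 `^ e); first by rewrite divr_ge0 ?sqr_ge0 ?powR_ge0.
move=> l ll0; have lgt0 := lt_le_trans l00 ll0.
pose t := l / l0; have t1 : 1 <= t by rewrite ler_pdivlMr// mul1r.
have t0 := lt_le_trans ltr01 t1.
have lE : l = t * l0 by rewrite /t divfK// gt_eqF.
have th1 : 1 <= t `^ h by rewrite -(powRr0 t) ler_powR// ltW.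
have lnt : ln t <= t `^ h / h.
  rewrite ler_pdivlMr// mulrC -ln_powR; apply/ltW/ln_sublinear; exact: powR_gt0.
have lnl : `|ln l| <= B * t `^ h.
  rewrite lE lnM ?posrE//; apply: le_trans (ler_normD _ _) _.
  rewrite [`|ln t|]ger0_norm ?ln_ge0// /B mulrDl addrC lerD//; last by rewrite mulrC.
  by rewrite ler_peMr.
have -> : B ^+ 2 / l0 `^ e * l `^ e = (B * t `^ h) ^+ 2.
  rewrite {1}lE powRM ?ltW// exprMn -[t `^ h ^+ 2]powR_mulrn ?powR_ge0//.
  rewrite -powRrM divfK//.
  by rewrite mulrA mulrAC mulrVK// ?unitfE ?gt_eqF ?powR_gt0.
rewrite -[ln l ^+ 2]real_normK ?num_real// ler_sqr ?nnegrE//.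
by rewrite mulr_ge0 ?powR_ge0.
Qed.

Lemma cvg_residual_bound (R : realType) (lam a c : nat -> R) (l0 eps : R) :
  0 < l0 -> (forall m, l0 <= lam m) -> 0 < eps ->
  cvgn (series (fun m => lam m `^ eps * a m ^+ 2)) ->
  cvgn (series (fun m => a m ^+ 2)) -> cvgn (series (fun m => c m ^+ 2)) ->
  cvgn (series (fun m => (ln (lam m) * a m) ^+ 2 + a m ^+ 2 + c m ^+ 2)).
Proof.
move=> l00 lamge eps0 cla ca cc.
have [C C0 HC] := ln_sqr_le_powR l00 eps0.
apply: is_cvg_seriesD cc; apply: is_cvg_seriesD ca.
apply: (@series_le_cvg _ _ (fun m => C * (lam m `^ eps * a m ^+ 2))) => [m|m|m|].
- exact: sqr_ge0.
- by rewrite mulr_ge0// mulr_ge0 ?powR_ge0 ?sqr_ge0.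
- by rewrite exprMn [leRHS]mulrA ler_wpM2r ?sqr_ge0// HC.
- exact: is_cvg_seriesZ cla.
Qed.

Lemma cvg_residual (R : realType) (alpha s : R) (lam a c : nat -> R) :
  0 < alpha -> (forall m, 0 < lam m) ->
  cvgn (series (fun m => a m ^+ 2)) -> cvgn (series (fun m => c m ^+ 2)) ->
  cvgn (series (fun m => residual alpha (lam m) (a m) (c m) s)).
Proof.
move=> alpha0 lam0 ca cc.
apply: (@series_le_cvg _ _ (fun m => 2 * a m ^+ 2 + 2 * c m ^+ 2)) => [m|m|m|].
- exact: sqr_ge0.
- by rewrite addr_ge0// mulr_ge0 ?sqr_ge0.
- rewrite /residual.
  have y0 := mulr_gt0 alpha0 (powR_gt0 s (lam0 m)).
  have : (a m / (1 + alpha * lam m `^ s)) ^+ 2 <= a m ^+ 2.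
    rewrite exprMn ler_piMr ?sqr_ge0// exprVn invf_le1 ?exprn_gt0 ?addr_gt0//.
    by rewrite exprn_ege1// lerDl ltW.
  move: (_ / _) => r r1; have := sqr_ge0 (r + c m); nra.
- by apply: is_cvg_seriesD;
    [exact: (is_cvg_seriesZ ca)|exact: (is_cvg_seriesZ cc)].
Qed.

Theorem corollary6p3 (R : realType) (n : nat) (Om : set 'rV[R]_n.+1)
  (hOm : bounded_lipschitz_domain Om)
  (lam : nat -> R) (psi : nat -> 'rV[R]_n.+1 -> R)
  (hpsi : dirichlet_eigenbasis Om lam psi)
  (N : nat) (alpha : R) (halpha : 0 < alpha)
  (uc ueta : 'I_N -> 'rV[R]_n.+1 -> R)
  (huc : forall j, L2 Om (uc j))
  (eps : R) (heps : 0 < eps < 1)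
  (hueta : forall j, Hs Om lam psi eps (ueta j))
  (h0 : 0 < \sum_(j < N) limn (series (fun m : nat =>
     ln (lam m) * coef Om psi (ueta j) m *
     (coef Om psi (ueta j) m - (1 + alpha) * coef Om psi (uc j) m))))
  (h1 : \sum_(j < N) limn (series (fun m : nat =>
     ln (lam m) * lam m / (1 + alpha * lam m) ^+ 3 * coef Om psi (ueta j) m *
     (coef Om psi (ueta j) m
        - (1 + alpha * lam m) * coef Om psi (uc j) m))) < 0) :
  (forall (s : R) (j : 'I_N), 0 < s < 1 ->
     unique_minimizer Om lam psi alpha s (ueta j)
       (reconstruction Om lam psi alpha s (ueta j))) /\
  exists2 sbar : R, 0 < sbar < 1 &
    forall s : R, 0 < s < 1 ->
      upper_level Om lam psi alpha uc ueta sbar <=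
      upper_level Om lam psi alpha uc ueta s.
Proof.
have [psi_basis _ lam00 lam_nd _] := hpsi.
have lam_ge m : lam 0%N <= lam m by exact: lam_nd.
have lam_gt0 m : 0 < lam m := lt_le_trans lam00 (lam_ge m).
have Lueta j : L2 Om (ueta j) by have [] := hueta j.
split=> [s j _|]; first exact: reconstruction_unique.
pose a j m := coef Om psi (ueta j) m; pose c j m := coef Om psi (uc j) m.
have cvg_coef u : L2 Om u -> cvgn (series (fun m => coef Om psi u m ^+ 2)).
  by move=> Lu; apply/cvg_ex; eexists; exact: parseval.
pose f j m := residual alpha (lam m) (a j m) (c j m).
pose f' j m := dresidual alpha (lam m) (a j m) (c j m).
pose M j m := (ln (lam m) * a j m) ^+ 2 + a j m ^+ 2 + c j m ^+ 2.
have f'M j m s : `|f' j m s| <= M j m by exact: dresidual_le.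
have cM j : cvgn (series (M j)).
  have /andP[eps0 _] := heps; have /HsP[_ cj] := hueta j.
  by apply: (cvg_residual_bound lam00 lam_ge eps0) => //; exact: cvg_coef.
have cf' j s : cvgn (series (fun m => f' j m s)).
  apply: normed_cvg.
  apply: series_le_cvg (cM j) => m; [exact: normr_ge0| |exact: f'M].
  by rewrite !addr_ge0 ?sqr_ge0.
pose F s := \sum_j limn (series (fun m => f j m s)).
pose F' s := \sum_j limn (series (fun m => f' j m s)).
have FE s : upper_level Om lam psi alpha uc ueta s = F s by rewrite upper_levelE.
have dF (s : R) : is_derive s 1 F (F' s).
  rewrite (_ : F = \sum_(j < N) (fun t => limn (series (fun m => f j m t)))).
    apply: is_derive_sum => j; apply: (is_derive_series (M := M j)) => //.
      by move=> m y; exact: is_derive_residual.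
    by move=> y; apply: cvg_residual => //; exact: cvg_coef.
  by apply/funext => t; rewrite fct_sumE.
have F'scale k s (g : 'I_N -> nat -> R) : (forall j m, g j m = k * f' j m s) ->
    \sum_j limn (series (g j)) = k * F' s.
  move=> gE; rewrite /F' mulr_sumr; apply: eq_bigr => j _.
  have -> : g j = k *: (fun m => f' j m s) by apply/funext => m; rewrite gE.
  exact: lim_seriesZ.
have F'0 : F' 0 < 0.
  have k0 : - ((1 + alpha) ^+ 3 / (2 * alpha)) < 0.
    by rewrite oppr_lt0 divr_gt0 ?exprn_gt0 ?mulr_gt0 ?addr_gt0.
  move: h0; rewrite (F'scale (- ((1 + alpha) ^+ 3 / (2 * alpha))) 0).
    by rewrite nmulr_rgt0.
  move=> j m; rewrite /f' /dresidual powRr0 !mulr1 -/(a j m) -/(c j m).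
  by field; rewrite !gt_eqF// addr_gt0.
have F'1 : 0 < F' 1.
  have k0 : - (2 * alpha)^-1 < 0 by rewrite oppr_lt0 invr_gt0 mulr_gt0.
  move: h1; rewrite (F'scale (- (2 * alpha)^-1) 1).
    by rewrite nmulr_rlt0.
  move=> j m; rewrite /f' /dresidual powRr1 ?ltW// -/(a j m) -/(c j m).
  have := mulr_gt0 halpha (lam_gt0 m) => y0.
  by field; rewrite !gt_eqF// addr_gt0.
have [sbar sbar01 Fmin] := interior_minimum ltr01 dF F'0 F'1.
exists sbar; first exact: sbar01.
by move=> s s01; rewrite !FE; exact: Fmin.
Qed.
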